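(* Let $n\ge 2$ and let $X$ be a switch. Then $\varphi: B\mapsto\varphi_B$ defines a contravariant functor $\mathcal{B}_n\to\mathrm{Aut}(X^n)$ (that is, every $\varphi_B$ lies in $\mathrm{Aut}(X^n)$, and $\varphi$ is a group anti-homomorphism $\mathcal{B}_n\to\mathrm{Aut}(X^n)$) if and only if $X$ is medial.
   Context: A switch is a set $X$ with an invertible map $\rho:X\times X\to X\times X$ satisfying the set-theoretic Yang-Baxter equation $(\rho\times\mathrm{Id}_X)(\mathrm{Id}_X\times\rho)(\rho\times\mathrm{Id}_X)=(\mathrm{Id}_X\times\rho)(\rho\times\mathrm{Id}_X)(\mathrm{Id}_X\times\rho)$. Write $\rho=(\rho_1,\rho_2)$ and define binary operations on $X$ by $x\mathbin{\underline{\triangledown}}y=\rho_2(x,y)$ and $x\mathbin{\overline{\triangledown}}y=\rho_1(y,x)$, so that $\rho(x,y)=(y\mathbin{\overline{\triangledown}}x,\;x\mathbin{\underline{\triangledown}}y)$. The product switch structure on $X^n$ is the one whose operations $\underline{\triangledown},\overline{\triangledown}$ are computed componentwise from those of $X$, i.e. $\rho((x_i)_i,(y_i)_i)=((\rho_1(x_i,y_i))_i,(\rho_2(x_i,y_i))_i)$. A switch homomorphism from $(X,\rho)$ to $(Y,\tau)$ is a map $f:X\to Y$ with $\tau(f(x),f(y))=(f(\rho_1(x,y)),f(\rho_2(x,y)))$ for all $x,y\in X$; equivalently, $f$ preserves both operations. $\mathrm{Aut}(X^n)$ is the group of switch automorphisms of the switch $X^n$ (bijective switch homomorphisms $X^n\to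 X^n$, with product structure). A switch $X$ is medial if for all $x,y,w,z\in X$: $(x\mathbin{\underline{\triangledown}}y)\mathbin{\underline{\triangledown}}(w\mathbin{\underline{\triangledown}}z)=(x\mathbin{\underline{\triangledown}}w)\mathbin{\underline{\triangledown}}(y\mathbin{\underline{\triangledown}}z)$, $(x\mathbin{\underline{\triangledown}}y)\mathbin{\overline{\triangledown}}(w\mathbin{\underline{\triangledown}}z)=(x\mathbin{\overline{\triangledown}}w)\mathbin{\underline{\triangledown}}(y\mathbin{\overline{\triangledown}}z)$, $(x\mathbin{\overline{\triangledown}}y)\mathbin{\overline{\triangledown}}(w\mathbin{\overline{\triangledown}}z)=(x\mathbin{\overline{\triangledown}}w)\mathbin{\overline{\triangledown}}(y\mathbin{\overline{\triangledown}}z)$. $\mathcal{B}_n$ is the $n$-strand braid group with Artin generators $\sigma_1,\dots,\sigma_{n-1}$, viewed as a one-object category; the product is vertical stacking, words being read from top to bottom. For $B\in\mathcal{B}_n$, $\varphi_B:X^n\to X^n$ sends the vector of colors at the top of $B$ to the vector of colors induced at the bottom: $\varphi_{\sigma_i}(x_1,\dots,x_n)=(x_1,\dots,x_{i-1},\rho_1(x_i,x_{i+1}),\rho_2(x_i,x_{i+1}),x_{i+2},\dots,x_n)$, $\varphi_{\sigma_i^{-1}}=\varphi_{\sigma_i}^{-1}$, and $\varphi_{B_1B_2}=\varphi_{B_2}\circ\varphi_{B_1}$. (It is known that this is well defined on $\mathcal{B}_n$.) *)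

(* Defs.v *)
From HB Require Import structures.
From mathcomp Require Import all_boot.
From mathcomp Require Import generic_quotient.
From mathcomp Require Import boolp.

Set Implicit Arguments.
Unset Strict Implicit.
Unset Printing Implicit Defensive.

Definition act12 (X : Type) (r : X * X -> X * X) (t : X * X * X) : X * X * X :=
  (r t.1, t.2).

Definition act23 (X : Type) (r : X * X -> X * X) (t : X * X * X) : X * X * X :=
  (t.1.1, (r (t.1.2, t.2)).1, (r (t.1.2, t.2)).2).

Definition yang_baxter (X : Type) (r : X * X -> X * X) : Prop :=
  act12 r \o act23 r \o act12 r =1 act23 r \o act12 r \o act23 r.

HB.mixin Record isSwitch X := {
  rho : X * X -> X * X;
  rhoV : X * X -> X * X;
  rhoK : cancel rho rhoV;
  rhoVK : cancel rhoV rho;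
  rho_ybe : yang_baxter rho
}.

#[short(type="switchType")]
HB.structure Definition Switch := {X of isSwitch X}.

(* The underlined and overlined triangle operations, so that
   [rho (x, y) = (otri y x, utri x y)]: beware the swapped arguments. *)
Definition utri {X : switchType} (x y : X) : X := (rho (x, y)).2.
Definition otri {X : switchType} (x y : X) : X := (rho (y, x)).1.

Definition medial (X : switchType) : Prop :=
  forall x y w z : X,
    [/\ utri (utri x y) (utri w z) = utri (utri x w) (utri y z),
        otri (utri x y) (utri w z) = utri (otri x w) (otri y z)
      & otri (otri x y) (otri w z) = otri (otri x w) (otri y z)].

Definition switch_hom (X Y : switchType) (f : X -> Y) : Prop :=
  forall x y : X, rho (f x, f y) = (f (rho (x, y)).1, f (rho (x, y)).2).

Lemma switch_homE (X Y : switchType) (f : X -> Y) :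
  switch_hom f <->
  (forall x y, f (utri x y) = utri (f x) (f y)) /\
  (forall x y, f (otri x y) = otri (f x) (f y)).
Proof.
split=> [hf | [hu ho] x y].
  by split=> x y; rewrite /utri /otri hf.
by rewrite [LHS]surjective_pairing -[RHS]/(f (otri y x), f (utri x y)) ho hu.
Qed.

Definition lift_prod (I : finType) (X : Type) (r : X * X -> X * X)
    (p : {ffun I -> X} * {ffun I -> X}) : {ffun I -> X} * {ffun I -> X} :=
  ([ffun i => (r (p.1 i, p.2 i)).1], [ffun i => (r (p.1 i, p.2 i)).2]).

Lemma lift_prodK (I : finType) (X : Type) (r s : X * X -> X * X) :
  cancel r s -> cancel (@lift_prod I X r) (lift_prod s).
Proof.
move=> rK [x y]; rewrite /lift_prod /=.
by congr pair; apply/ffunP => i; rewrite !ffunE -surjective_pairing rK.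
Qed.

Lemma lift_prod_ybe (I : finType) (X : Type) (r : X * X -> X * X) :
  yang_baxter r -> yang_baxter (@lift_prod I X r).
Proof.
move=> ybe [[x y] z].
have E i := ybe (x i, y i, z i).
rewrite /act12 /act23 /lift_prod /= in E *.
congr (_, _, _); apply/ffunP => i; rewrite !ffunE /= -?surjective_pairing.
- exact: (congr1 (fun t => t.1.1) (E i)).
- exact: (congr1 (fun t => t.1.2) (E i)).
- exact: (congr1 (fun t => t.2) (E i)).
Qed.

HB.instance Definition _ (I : finType) (X : switchType) :=
  isSwitch.Build {ffun I -> X}
    (lift_prodK (@rhoK X)) (lift_prodK (@rhoVK X)) (lift_prod_ybe (@rho_ybe X)).

Record Aut (X : switchType) := MkAut {
  aut_fun :> X -> X;
  aut_bij : bijective aut_fun;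
  aut_hom : switch_hom aut_fun
}.

Lemma aut_inj (X : switchType) (f g : Aut X) : f =1 g -> f = g.
Proof.
case: f g => [f bf hf] [g bg hg] /= /funext fg; subst g.
by congr MkAut; exact: Prop_irrelevance.
Qed.

HB.instance Definition _ (X : switchType) := gen_eqMixin (Aut X).
HB.instance Definition _ (X : switchType) := gen_choiceMixin (Aut X).

Lemma hom_id (X : switchType) : switch_hom (@id X).
Proof. by move=> x y; exact: surjective_pairing. Qed.

Definition aut_one (X : switchType) : Aut X :=
  MkAut (@Bijective _ _ (@id X) id (frefl _) (frefl _)) (@hom_id X).

Lemma hom_comp (X : switchType) (f g : Aut X) : switch_hom (f \o g).
Proof. by move=> x y; rewrite /= (aut_hom f) (aut_hom g). Qed.

(* The product of the group [Aut X] is composition: [f * g] is [f \o g]. *)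
Definition aut_mul (X : switchType) (f g : Aut X) : Aut X :=
  MkAut (bij_comp (aut_bij f) (aut_bij g)) (@hom_comp X f g).

Lemma aut_inv_subproof (X : switchType) (f : Aut X) :
  exists g : Aut X, cancel f g /\ cancel g f.
Proof.
have [g fK gK] := aut_bij f.
have hg : switch_hom g.
  move=> x y; have := aut_hom f (g x) (g y); rewrite !gK => ->.
  by rewrite !fK -surjective_pairing.
by exists (MkAut (@Bijective _ _ g f gK fK) hg).
Qed.

Definition aut_inv (X : switchType) (f : Aut X) : Aut X :=
  projT1 (cid (aut_inv_subproof f)).

Lemma aut_mulA (X : switchType) : associative (@aut_mul X).
Proof. by move=> f g h; exact: aut_inj. Qed.

Lemma aut_mul1 (X : switchType) : left_id (aut_one X) (@aut_mul X).
Proof. by move=> f; exact: aut_inj. Qed.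

Lemma aut_1mul (X : switchType) : right_id (aut_one X) (@aut_mul X).
Proof. by move=> f; exact: aut_inj. Qed.

Lemma aut_mulV (X : switchType) :
  left_inverse (aut_one X) (@aut_inv X) (@aut_mul X).
Proof.
by move=> f; apply: aut_inj => x; rewrite /= /aut_inv; case: cid => /= g [+ _].
Qed.

Lemma aut_Vmul (X : switchType) :
  right_inverse (aut_one X) (@aut_inv X) (@aut_mul X).
Proof.
by move=> f; apply: aut_inj => x; rewrite /= /aut_inv; case: cid => /= g [_ +].
Qed.

HB.instance Definition _ (X : switchType) := isGroup.Build (Aut X)
  (@aut_mulA X) (@aut_mul1 X) (@aut_1mul X) (@aut_mulV X) (@aut_Vmul X).

(* A word in the Artin generators and their inverses, read from top to bottom
   (left to right).  Generators are indexed from 0: [(i, false)] is the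
   crossing of strands [i] and [i.+1], and [(i, true)] is its inverse. *)
Definition letter (n : nat) : Type := ('I_n.-1 * bool)%type.
Definition word (n : nat) : Type := seq (letter n).

Definition letter_inv (n : nat) (s : letter n) : letter n := (s.1, ~~ s.2).
Definition sigma (n : nat) (i : 'I_n.-1) : letter n := (i, false).

Inductive braid_eq (n : nat) : word n -> word n -> Prop :=
| BraidRefl w : braid_eq w w
| BraidSym v w : braid_eq v w -> braid_eq w v
| BraidTrans u v w : braid_eq u v -> braid_eq v w -> braid_eq u w
| BraidCat v v' w w' :
    braid_eq v v' -> braid_eq w w' -> braid_eq (v ++ w) (v' ++ w')
| BraidInv s : braid_eq [:: s; letter_inv s] [::]
| BraidFar (i j : 'I_n.-1) : i.+1 < j ->
    braid_eq [:: sigma i; sigma j] [:: sigma j; sigma i]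
| BraidNear (i j : 'I_n.-1) : j = i.+1 :> nat ->
    braid_eq [:: sigma i; sigma j; sigma i] [:: sigma j; sigma i; sigma j].

Definition braid_rel (n : nat) : rel (word n) := fun v w => `[< braid_eq v w >].

Lemma braid_rel_refl n : reflexive (@braid_rel n).
Proof. by move=> w; apply/asboolP; exact: BraidRefl. Qed.

Lemma braid_rel_sym n : symmetric (@braid_rel n).
Proof. by move=> v w; apply/asboolP/asboolP; exact: BraidSym. Qed.

Lemma braid_rel_trans n : transitive (@braid_rel n).
Proof.
by move=> v u w /asboolP uv /asboolP vw; apply/asboolP; exact: BraidTrans vw.
Qed.

Canonical braid_equiv (n : nat) : equiv_rel (word n) :=
  EquivRel (@braid_rel n)
    (@braid_rel_refl n) (@braid_rel_sym n) (@braid_rel_trans n).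

Definition braid (n : nat) : Type := {eq_quot (braid_equiv n)}%qT.

HB.instance Definition _ (n : nat) := Choice.on (braid n).
HB.instance Definition _ (n : nat) := EqQuotient.on (braid n).

Definition braid_of_word (n : nat) (w : word n) : braid n := \pi_(braid n)%qT w.

Lemma braidP n (v w : word n) :
  braid_of_word v = braid_of_word w <-> braid_eq v w.
Proof.
split; first by move=> /eqquotP /asboolP.
by move=> h; apply/eqquotP/asboolP.
Qed.

Lemma repr_braidK n : cancel (@repr _ (braid n)) (@braid_of_word n).
Proof. by move=> B; exact: reprK. Qed.

Lemma braid_repr n (w : word n) : braid_eq (repr (braid_of_word w)) w.
Proof. by apply/braidP; rewrite repr_braidK. Qed.

Definition word_inv (n : nat) (w : word n) : word n :=
  rev (map (@letter_inv n) w).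

Lemma letter_invK n : involutive (@letter_inv n).
Proof. by case=> i b; rewrite /letter_inv /= negbK. Qed.

Lemma word_invK n : involutive (@word_inv n).
Proof.
by move=> w; rewrite /word_inv map_rev revK mapK //; exact: letter_invK.
Qed.

Lemma word_mulV n (w : word n) : braid_eq (w ++ word_inv w) [::].
Proof.
elim: w => [|s w IHw]; first exact: BraidRefl.
rewrite /word_inv /= rev_cons -cats1.
apply: (BraidTrans _ (BraidInv s)).
apply: (@BraidCat _ [:: s] [:: s]); first exact: BraidRefl.
rewrite catA -{2}[[:: letter_inv s]]cat0s.
by apply: BraidCat => //; exact: BraidRefl.
Qed.

Definition braid_one (n : nat) : braid n := braid_of_word [::].

Definition braid_mul (n : nat) (A B : braid n) : braid n :=
  braid_of_word (repr A ++ repr B).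

Definition braid_inv (n : nat) (A : braid n) : braid n :=
  braid_of_word (word_inv (repr A)).

Lemma braid_of_word_cat n (v w : word n) :
  braid_of_word (v ++ w) = braid_mul (braid_of_word v) (braid_of_word w).
Proof.
by apply/braidP/BraidSym/BraidCat; exact: braid_repr.
Qed.

Lemma braid_mulA n : associative (@braid_mul n).
Proof.
move=> A B C; rewrite -(repr_braidK A) -(repr_braidK B) -(repr_braidK C).
by rewrite -!braid_of_word_cat catA.
Qed.

Lemma braid_mul1 n : left_id (braid_one n) (@braid_mul n).
Proof. by move=> A; rewrite -(repr_braidK A) -braid_of_word_cat. Qed.

Lemma braid_1mul n : right_id (braid_one n) (@braid_mul n).
Proof. by move=> A; rewrite -(repr_braidK A) -braid_of_word_cat cats0. Qed.

Lemma braid_mulV n : right_inverse (braid_one n) (@braid_inv n) (@braid_mul n).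
Proof.
move=> A; rewrite /braid_inv -{1}(repr_braidK A) -braid_of_word_cat.
by apply/braidP; exact: word_mulV.
Qed.

Lemma braid_Vmul n : left_inverse (braid_one n) (@braid_inv n) (@braid_mul n).
Proof.
move=> A; rewrite /braid_inv -{2}(repr_braidK A) -braid_of_word_cat.
by apply/braidP; rewrite -{2}(word_invK (repr A)); exact: word_mulV.
Qed.

HB.instance Definition _ (n : nat) := isGroup.Build (braid n)
  (@braid_mulA n) (@braid_mul1 n) (@braid_1mul n)
  (@braid_Vmul n) (@braid_mulV n).

Lemma strand_right_subproof (n : nat) (i : 'I_n.-1) : i.+1 < n.
Proof. by rewrite -ltn_predRL. Qed.

Definition strand_left (n : nat) (i : 'I_n.-1) : 'I_n :=
  widen_ord (leq_pred n) i.
Definition strand_right (n : nat) (i : 'I_n.-1) : 'I_n :=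
  Ordinal (strand_right_subproof i).

Definition act_at (n : nat) (X : Type) (r : X * X -> X * X) (i : 'I_n.-1)
    (x : {ffun 'I_n -> X}) : {ffun 'I_n -> X} :=
  let p := r (x (strand_left i), x (strand_right i)) in
  [ffun k => if k == strand_left i then p.1
             else if k == strand_right i then p.2
             else x k].

Definition letter_act (n : nat) (X : switchType) (s : letter n) :
    {ffun 'I_n -> X} -> {ffun 'I_n -> X} :=
  act_at (if s.2 then rhoV else rho) s.1.

Definition word_act (n : nat) (X : switchType) (w : word n)
    (x : {ffun 'I_n -> X}) : {ffun 'I_n -> X} :=
  foldl (fun y s => letter_act s y) x w.

(* [phi X B] is computed on a representative word of [B]; by [phi_word] below
   the result does not depend on that word. *)
Definition phi (n : nat) (X : switchType) (B : braid n) :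
    {ffun 'I_n -> X} -> {ffun 'I_n -> X} :=
  word_act (repr B).
Arguments phi {n} X B.

Lemma strand_neq n (i : 'I_n.-1) : (strand_right i == strand_left i) = false.
Proof. by apply/eqP => /(congr1 val) /= /eqP; rewrite gtn_eqF. Qed.

Lemma act_at_left n X r (i : 'I_n.-1) (x : {ffun 'I_n -> X}) :
  act_at r i x (strand_left i) = (r (x (strand_left i), x (strand_right i))).1.
Proof. by rewrite ffunE eqxx. Qed.

Lemma act_at_right n X r (i : 'I_n.-1) (x : {ffun 'I_n -> X}) :
  act_at r i x (strand_right i) = (r (x (strand_left i), x (strand_right i))).2.
Proof. by rewrite ffunE strand_neq eqxx. Qed.

Lemma act_at_out n X r (i : 'I_n.-1) (x : {ffun 'I_n -> X}) k :
  k != strand_left i -> k != strand_right i -> act_at r i x k = x k.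
Proof. by move=> /negbTE kl /negbTE kr; rewrite ffunE kl kr. Qed.

Lemma act_atP n X (i : 'I_n.-1) (x y : {ffun 'I_n -> X}) :
  x (strand_left i) = y (strand_left i) ->
  x (strand_right i) = y (strand_right i) ->
  (forall k, k != strand_left i -> k != strand_right i -> x k = y k) ->
  x = y.
Proof.
move=> el er eo; apply/ffunP => k.
have [->//|kl] := eqVneq k (strand_left i).
by have [->//|kr] := eqVneq k (strand_right i); exact: eo.
Qed.

Lemma act_atK n X r r' (i : 'I_n.-1) :
  cancel r r' -> cancel (@act_at n X r i) (act_at r' i).
Proof.
move=> rK x; apply: (@act_atP n X i) => [||k kl kr].
- by rewrite act_at_left act_at_left act_at_right -surjective_pairing rK.
- by rewrite act_at_right act_at_left act_at_right -surjective_pairing rK.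
- by rewrite !act_at_out.
Qed.

Lemma letter_actK n (X : switchType) (s : letter n) :
  cancel (@letter_act n X s) (letter_act (letter_inv s)).
Proof.
by case: s => i [] /=; apply: act_atK; [exact: rhoVK | exact: rhoK].
Qed.

Lemma act_at_far n X r (i j : 'I_n.-1) (x : {ffun 'I_n -> X}) : i.+1 < j ->
  act_at r j (act_at r i x) = act_at r i (act_at r j x).
Proof.
move=> ij.
have neq (a b : 'I_n) : a < b -> b != a.
  by move=> ab; apply: contraTneq ab => ->; rewrite ltnn.
have ij' : i < j by rewrite ltnW.
have ll : strand_left j != strand_left i by exact: neq.
have lr : strand_left j != strand_right i by exact: neq.
have rl : strand_right j != strand_left i by apply: neq; exact: ltnW.
have rr : strand_right j != strand_right i by apply: neq; exact: ltnW.
apply: (@act_atP n X i) => [||k kl kr].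
- by rewrite act_at_out 1?eq_sym // !act_at_left !(@act_at_out n X r j) 1?eq_sym.
- by rewrite act_at_out 1?eq_sym // !act_at_right !(@act_at_out n X r j) 1?eq_sym.
rewrite [RHS]act_at_out // !ffunE (negbTE ll) (negbTE lr) (negbTE rl) (negbTE rr).
by rewrite (negbTE kl) (negbTE kr).
Qed.

Lemma act_at_near n X r (i j : 'I_n.-1) (x : {ffun 'I_n -> X}) :
  yang_baxter r -> j = i.+1 :> nat ->
  act_at r i (act_at r j (act_at r i x)) =
  act_at r j (act_at r i (act_at r j x)).
Proof.
move=> ybe ji.
have E : strand_left j = strand_right i by exact: val_inj.
have Nl : (strand_right j == strand_left i) = false.
  by apply/eqP => /(congr1 val) /= /eqP; rewrite ji gtn_eqF // ltnW.
have Nr : (strand_right j == strand_right i) = false.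
  by rewrite -E strand_neq.
have := ybe (x (strand_left i), x (strand_right i), x (strand_right j)).
rewrite /yang_baxter /act12 /act23 /=.
case e1 : (r (x (strand_left i), x (strand_right i))) => [a b] /=.
case e2 : (r (x (strand_right i), x (strand_right j))) => [c d] /=.
case e3 : (r (b, x (strand_right j))) => [e f] /=.
case e4 : (r (x (strand_left i), c)) => [g h] /=.
move=> -[e5 e6].
apply/ffunP => k; rewrite !ffunE !E !eqxx ?Nl ?Nr ?strand_neq.
rewrite ![strand_left i == _]eq_sym ?Nl ?Nr ?strand_neq ?eqxx.
rewrite e1 e2 /= e3 e4 /= e5.
have [->|kl] := eqVneq k (strand_left i).
  by rewrite ![strand_left i == _]eq_sym strand_neq Nl.
have [_|kr] := eqVneq k (strand_right i); first by [].
by rewrite e6; case: ifP.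
Qed.

Lemma word_act_cat n (X : switchType) (v w : word n) (x : {ffun 'I_n -> X}) :
  word_act (v ++ w) x = word_act w (word_act v x).
Proof. exact: foldl_cat. Qed.

Lemma word_act_braid_eq n (X : switchType) (v w : word n) :
  braid_eq v w -> @word_act n X v =1 word_act w.
Proof.
elim=> {v w} //.
- by move=> v w _ IH x; rewrite IH.
- by move=> u v w _ IH1 _ IH2 x; rewrite IH1 IH2.
- by move=> v v' w w' _ IH1 _ IH2 x; rewrite !word_act_cat IH1 IH2.
- by move=> s x; exact: letter_actK.
- by move=> i j ij x; exact: act_at_far.
- by move=> i j ji x; apply: act_at_near => //; exact: rho_ybe.
Qed.

Lemma phi_word n (X : switchType) (w : word n) :
  phi X (braid_of_word w) =1 word_act w.
Proof. by apply: word_act_braid_eq; exact: braid_repr. Qed.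

(* A group is a one-object category whose composition is its product, so a
   contravariant functor between groups is an anti-homomorphism. *)
Definition contravariant (G H : groupType) (F : G -> H) : Prop :=
  F 1%g = 1%g /\ forall A B : G, F (A * B)%g = (F B * F A)%g.

(* Main.v *)
Require Import Defs.
From mathcomp Require Import all_boot.

(** The braid group is generated by crossings, so everything reduces to one crossing.
    Only two coordinates move under a crossing, and on those it is the map
    [rho : X ^ 2 -> X ^ 2], [rho (a, b) = (otri b a, utri a b)].  Saying that
    this map preserves the two componentwise operations of [X ^ 2] gives two
    coordinate equations for each operation:
    - [utri], right strand: [utri] interchanges with itself;
    - [utri], left strand: [utri] and [otri] interchange;
    - [otri], right strand: the same mixed law, read from right to left;
    - [otri], left strand: [otri] interchanges with itself.
    These are the three medial laws, the mixed one occurring twice; hence the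
    key equivalence [crossing_homP].

    If [X] is medial, every positive crossing is thus an automorphism of the
    product switch; so is its inverse, and so is any composite, which makes
    [phi B] an automorphism for each braid [B].  Reversal of products holds
    because a word acts from top to bottom while automorphisms compose from
    right to left.  Conversely, two strands suffice to have a crossing, and
    that its action is a homomorphism forces the medial laws. *)

Lemma utri_ffunE (I : finType) (X : switchType) (x y : {ffun I -> X}) i :
  utri x y i = utri (x i) (y i).
Proof. by rewrite ffunE. Qed.

Lemma otri_ffunE (I : finType) (X : switchType) (x y : {ffun I -> X}) i :
  otri x y i = otri (x i) (y i).
Proof. by rewrite ffunE. Qed.

Lemma crossing_left n (X : switchType) (i : 'I_n.-1) (x : {ffun 'I_n -> X}) :
  act_at rho i x (strand_left i) = otri (x (strand_right i)) (x (strand_left i)).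
Proof. exact: act_at_left. Qed.

Lemma crossing_right n (X : switchType) (i : 'I_n.-1) (x : {ffun 'I_n -> X}) :
  act_at rho i x (strand_right i) =
  utri (x (strand_left i)) (x (strand_right i)).
Proof. exact: act_at_right. Qed.

(** The medial laws are the coordinates of the homomorphism equations at the
    two strands that cross; at any other strand both sides agree trivially. *)
Lemma crossing_homP n (X : switchType) (i : 'I_n.-1) :
  switch_hom (act_at (@rho X) i) <-> medial X.
Proof.
rewrite switch_homE; split=> [[hu ho] x y w z | med].
  pose v (a b : X) : {ffun 'I_n -> X} :=
    [ffun k => if k == strand_left i then a else b].
  have vl a b : v a b (strand_left i) = a by rewrite ffunE eqxx.
  have vr a b : v a b (strand_right i) = b by rewrite ffunE strand_neq.
  (* The color leaving on the left is [otri] of the right color by the left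
     one, so [v] takes its arguments in the opposite order in the two laws
     read there. *)
  split.
  - have /ffunP/(_ (strand_right i)) := hu (v x w) (v y z).
    by rewrite utri_ffunE !crossing_right !utri_ffunE !vl !vr.
  - have /ffunP/(_ (strand_left i)) := hu (v w x) (v z y).
    by rewrite utri_ffunE !crossing_left !utri_ffunE !vl !vr.
  - have /ffunP/(_ (strand_left i)) := ho (v w x) (v z y).
    by rewrite otri_ffunE !crossing_left !otri_ffunE !vl !vr.
split=> x y; apply: (@act_atP n X i) => [||k kl kr].
- rewrite utri_ffunE !crossing_left !utri_ffunE.
  by case: (med (x (strand_right i)) (y (strand_right i))
                (x (strand_left i)) (y (strand_left i))).
- rewrite utri_ffunE !crossing_right !utri_ffunE.
  by case: (med (x (strand_left i)) (y (strand_left i))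
                (x (strand_right i)) (y (strand_right i))).
- by rewrite utri_ffunE !act_at_out // utri_ffunE.
- rewrite otri_ffunE !crossing_left !otri_ffunE.
  by case: (med (x (strand_right i)) (y (strand_right i))
                (x (strand_left i)) (y (strand_left i))).
- rewrite otri_ffunE !crossing_right !otri_ffunE.
  by case: (med (x (strand_left i)) (x (strand_right i))
                (y (strand_left i)) (y (strand_right i))).
- by rewrite otri_ffunE !act_at_out // otri_ffunE.
Qed.

Lemma can_switch_hom (X Y : switchType) (f : X -> Y) (g : Y -> X) :
  cancel f g -> cancel g f -> switch_hom f -> switch_hom g.
Proof.
move=> fK gK hf x y; have := hf (g x) (g y); rewrite !gK => ->.
by rewrite !fK -surjective_pairing.
Qed.

Lemma letter_act_hom n (X : switchType) (s : letter n) :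
  medial X -> switch_hom (@letter_act n X s).
Proof.
move=> med; have pos i : switch_hom (@letter_act n X (sigma i)).
  exact/(crossing_homP _ _ i).
case: s => i []; last exact: pos.
exact: can_switch_hom _ _ _ _ (@letter_actK n X (sigma i))
                              (@letter_actK n X (i, true)) (pos i).
Qed.

Lemma word_act_hom n (X : switchType) (w : word n) :
  medial X -> switch_hom (@word_act n X w).
Proof.
move=> med; elim: w => [|s w IHw] x y /=; first exact: surjective_pairing.
by rewrite IHw (@letter_act_hom n X s med).
Qed.

Lemma word_act_bij n (X : switchType) (w : word n) :
  bijective (@word_act n X w).
Proof.
exists (word_act (word_inv w)) => x; rewrite -word_act_cat.
  exact: word_act_braid_eq (word_mulV w) x.
rewrite -{2}(word_invK w); exact: word_act_braid_eq (word_mulV _) x.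
Qed.

Theorem corollary8 (n : nat) (X : switchType) (hn : 2 <= n) :
  (exists2 F : braid n -> Aut {ffun 'I_n -> X},
     forall B : braid n, F B =1 phi X B & contravariant F)
  <-> medial X.
Proof.
split=> [[F Fphi _] | med].
  have n1 : 0 < n.-1 by rewrite -ltnS prednK // ltnW.
  pose i := Ordinal n1.
  apply/(crossing_homP _ _ i) => x y.
  have E : F (braid_of_word [:: sigma i]) =1 act_at rho i.
    by move=> v; rewrite Fphi phi_word.
  by rewrite -!E; exact: aut_hom.
exists (fun B => MkAut (@word_act_bij n X (repr B))
                       (@word_act_hom n X (repr B) med)) => //.
split=> [|A B]; apply: aut_inj => x; first exact: phi_word [::] x.
by rewrite /= -word_act_cat; exact: (phi_word (repr A ++ repr B) x).
Qed.
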